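(* Let $F$ be the isotropic (ITQ) or anisotropic (ATQ) truncated quadratic functional, assume $F$ is level-bounded, let $\{x^t\}$ be a sequence generated by the algorithm preDCA$_e$ for minimizing $F$, and suppose that $x^t$ converges to some $\bar x$. Since $E(x,y)=F(x)+\frac12\|x-y\|_M^2$ is a KL function whose desingularizing function $\psi$ in the KL inequality takes, at the stationary point, the form $\psi(s)=cs^{1-\theta}$ with $\theta=\frac12$ and $c>0$, there exist $c_1>0$, $t_0>0$ and $\eta\in(0,1)$ such that $$\|x^t-\bar x\|<c_1\eta^t\qquad\text{for all }t>t_0.$$
   Context: Functionals. $X=\mathbb{R}^{m\times n}$ (identified with $\mathbb{R}^{mn}$), $\lambda,\mu>0$, $A:X\to\mathbb{R}^{m_0\times n_0}$ linear, $x_0\in\mathbb{R}^{m_0\times n_0}$. $\nabla=[\nabla_1,\nabla_2]^T$ is the discrete image gradient, $\nabla_1,\nabla_2:X\to X$ linear forward finite differences with homogeneous Neumann boundary condition: $(\nabla_1x)_{i,j}=x_{i+1,j}-x_{i,j}$ if $i<m$ and $0$ if $i=m$; $(\nabla_2x)_{i,j}=x_{i,j+1}-x_{i,j}$ if $j<n$ and $0$ if $j=n$; $|(\nabla x)_{i,j}|=\sqrt{(\nabla_1x)_{i,j}^2+(\nabla_2x)_{i,j}^2}$. (ITQ): $F(x)=\frac12\|Ax-x_0\|_2^2+\sum_{i,j}\frac\mu2\min(|(\nabla x)_{i,j}|^2,\frac\lambda\mu)$. (ATQ): $F(x)=\frac12\|Ax-x_0\|_2^2+\sum_{i,j}\frac\mu2\sum_{l=1}^2\min(|(\nabla_lx)_{i,j}|^2,\frac\lambda\mu)$.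 Set $P_1^I(x)=\sum_{i,j}\frac\mu2(|(\nabla x)_{i,j}|^2+\frac\lambda\mu)$, $P_2^I(x)=\sum_{i,j}\frac\mu2\max(|(\nabla x)_{i,j}|^2,\frac\lambda\mu)$, $P_1^A(x)=\sum_{i,j}\frac\mu2\sum_{l}(|(\nabla_lx)_{i,j}|^2+\frac\lambda\mu)$, $P_2^A(x)=\sum_{i,j}\frac\mu2\sum_l\max(|(\nabla_lx)_{i,j}|^2,\frac\lambda\mu)$; all are convex. Decomposition $F=f+P_1-P_2$: with $\bullet=I$ for (ITQ) and $\bullet=A$ for (ATQ), either (a) $f(x)=\frac12\|Ax-x_0\|_2^2$, $P_1=P_1^\bullet$, $P_2=P_2^\bullet$; or (b) $f=0$, $P_1(x)=\frac12\|Ax-x_0\|_2^2+P_1^\bullet(x)$, $P_2=P_2^\bullet$. $L\ge0$ is the Lipschitz constant of $\nabla f$ ($L=0$ in case (b)). Metric. $M$ is a self-adjoint linear operator on $X$ with $M\ge L_0\boldsymbol{I}$ (Loewner order), where $L_0>0$ and $L_0\ge L$; $\|x\|_M^2=\langle x,Mx\rangle$. Algorithm preDCA$_e$: take $x^0\in X$, $x^{-1}=x^0$, $\{\beta_t\}\subseteq[0,1)$ with $\sup_t\beta_t<1$; for $t=0,1,\dots$ take $\xi^t\in\partial P_2(x^t)$ (convex subdifferential), set $y^t=x^t+\beta_t(x^t-x^{t-1})$ and $x^{t+1}=\arg\min_y\{\langle\nabla f(y^t)-\xi^t,y\rangle+\frac12\|y-y^t\|_M^2+P_1(y)\}$. Choice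 of subgradient: $\xi^t=\mu\nabla^*\chi_{x^t}\nabla x^t$ for (ITQ), and $\xi^t=\mu(\nabla_1^*\chi_{x^t,1}\nabla_1+\nabla_2^*\chi_{x^t,2}\nabla_2)x^t$ for (ATQ), where $\chi_x$ multiplies the pixel $(i,j)$ by $1$ if $|(\nabla x)_{i,j}|\ge\sqrt{\lambda/\mu}$ and by $0$ otherwise, and $\chi_{x,l}$ multiplies the pixel $(i,j)$ by $1$ if $|(\nabla_lx)_{i,j}|\ge\sqrt{\lambda/\mu}$ and by $0$ otherwise. $F$ is level-bounded if $\{x:F(x)\le\alpha\}$ is bounded (possibly empty) for every $\alpha\in\mathbb{R}$. KL inequality: a proper closed $h$ satisfies the KL property at $\bar z\in\operatorname{dom}\partial h$ with $\psi(s)=cs^{1-\theta}$ if there are $a>0$ and a neighborhood $\mathcal{O}$ of $\bar z$ such that $\psi'(h(z)-h(\bar z))\operatorname{dist}(0,\partial h(z))\ge1$ whenever $z\in\mathcal{O}$ and $h(\bar z)<h(z)<h(\bar z)+a$; here $\partial h$ is the limiting subdifferential: $\xi\in\partial h(z)$ iff there are $z_k\to z$ with $h(z_k)\to h(z)$ and $\xi_k\to\xi$ with $\liminf_{w\to z_k,\,w\ne z_k}\frac{h(w)-h(z_k)-\langle\xi_k,w-z_k\rangle}{|w-z_k|}\ge0$ for every $k$. A stationary point of $h$ is a $z$ with $0\in\partial h(z)$. The KL property of $E$ mentioned in the claim (exponent $\frac12$ at its stationary points, which are of the form $(\bar x,\bar x)$ with $0\in\partial F(\bar x)$) is a fact valid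 in this setting, not an additional assumption. *)

(* Defs.v *)
From HB Require Import structures.
From mathcomp Require Import all_boot all_order all_algebra.
From mathcomp Require Import all_classical all_reals all_analysis.

Set Implicit Arguments.
Unset Strict Implicit.
Unset Printing Implicit Defensive.

Import Order.TTheory GRing.Theory Num.Theory.
Import numFieldNormedType.Exports.

Local Open Scope classical_set_scope.
Local Open Scope ring_scope.

(* The library norm [`|x|] on matrices is the sup norm; it is used only for
   topological notions (convergence, boundedness, punctured neighbourhoods,
   directional derivatives).  Every quantitative norm on matrices and on pairs
   of matrices below is the Euclidean one, [enorm dot] or [enorm dot2]. *)

Section InnerProducts.
Variable R : realType.

Definition dot m n (x y : 'M[R]_(m, n)) : R := \sum_i \sum_j x i j * y i j.

Definition dot2 m n (p q : 'M[R]_(m, n) * 'M[R]_(m, n)) : R :=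
  dot p.1 q.1 + dot p.2 q.2.

Definition enorm (V : Type) (ip : V -> V -> R) (v : V) : R := Num.sqrt (ip v v).

(* Hilbert adjoint of a linear map [f] into the inner product space [(W, ip)],
   given by its coordinates in the orthonormal basis [delta_mx i j];
   see [adjointP]. *)
Definition adjoint m n (W : Type) (ip : W -> W -> R) (f : 'M[R]_(m, n) -> W)
    (w : W) : 'M[R]_(m, n) :=
  \matrix_(i, j) ip (f (delta_mx i j)) w.

Lemma adjointP m n (W : lmodType R) (ip : W -> W -> R)
    (f : 'M[R]_(m, n) -> W) (w : W) (x : 'M[R]_(m, n)) :
  linear f -> (forall a u v, ip (a *: u + v) w = a * ip u w + ip v w) ->
  dot x (adjoint ip f w) = ip (f x) w.
Proof.
move=> flin iplin; set g := fun x => ip (f x) w.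
have glin a u v : g (a *: u + v) = a * g u + g v by rewrite /g flin iplin.
have g0 : g 0 = 0.
  by have /esym/eqP := glin 1 0 0; rewrite scaler0 addr0 mul1r -subr_eq0 addrK => /eqP.
have gD u v : g (u + v) = g u + g v by rewrite -[u]scale1r glin scale1r mul1r.
have gZ a u : g (a *: u) = a * g u by rewrite -[a *: u]addr0 glin g0 addr0.
rewrite -/(g x) {2}(matrix_sum_delta x) (big_morph g gD g0) /dot.
apply: eq_bigr => i _; rewrite (big_morph g gD g0).
by apply: eq_bigr => j _; rewrite gZ mxE.
Qed.

Definition gradient m n (f : 'M[R]_(m, n) -> R) (x : 'M[R]_(m, n)) :
    'M[R]_(m, n) :=
  \matrix_(i, j) 'D_(delta_mx i j) f x.

(* [L] is the least nonnegative Lipschitz constant of [g]. *)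
Definition lipschitz_constant m n (g : 'M[R]_(m, n) -> 'M[R]_(m, n)) (L : R) :=
  let lip K := 0 <= K /\
    forall x y, enorm (@dot m n) (g x - g y) <= K * enorm (@dot m n) (x - y) in
  lip L /\ forall K, lip K -> L <= K.

Definition self_adjoint m n (M : 'M[R]_(m, n) -> 'M[R]_(m, n)) :=
  forall x y, dot (M x) y = dot x (M y).

Definition loewner_ge m n (M : 'M[R]_(m, n) -> 'M[R]_(m, n)) (a : R) :=
  forall x, a * dot x x <= dot x (M x).

Definition sqnormM m n (M : 'M[R]_(m, n) -> 'M[R]_(m, n)) (x : 'M[R]_(m, n)) :=
  dot x (M x).

Definition convex_subdiff m n (P : 'M[R]_(m, n) -> R) (x : 'M[R]_(m, n)) :
    set 'M[R]_(m, n) :=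
  [set xi | forall y, P x + dot xi (y - x) <= P y].

Definition is_argmin (V : Type) (G : V -> R) (x : V) := forall y, G x <= G y.

Definition level_bounded m n (F : 'M[R]_(m, n) -> R) :=
  forall alpha, bounded_set [set x | F x <= alpha].

End InnerProducts.

Section ImageGradient.
Variables (R : realType) (m n : nat).
Local Notation X := 'M[R]_(m, n).

(* [insub i.+1 : option 'I_m] is [None] exactly when [i] is the last index. *)
Definition nabla1 (x : X) : X :=
  \matrix_(i, j) if insub i.+1 is Some i' then x i' j - x i j else 0.

Definition nabla2 (x : X) : X :=
  \matrix_(i, j) if insub j.+1 is Some j' then x i j' - x i j else 0.

Definition nablal (l : 'I_2) : X -> X := if l == ord0 then nabla1 else nabla2.

Definition nabla (x : X) : X * X := (nabla1 x, nabla2 x).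

Definition pixnorm (x : X) (i : 'I_m) (j : 'I_n) : R :=
  Num.sqrt (nabla1 x i j ^+ 2 + nabla2 x i j ^+ 2).

End ImageGradient.

Inductive tq_model := ITQ | ATQ.

(* Where the data term [1/2 |A x - x0|^2] goes in [F = f + P1 - P2]. *)
Inductive tq_splitting := data_in_f | data_in_P1.

Section TruncatedQuadratic.
Variables (R : realType) (m n m0 n0 : nat) (lambda mu : R).
Variables (A : 'M[R]_(m, n) -> 'M[R]_(m0, n0)) (x0 : 'M[R]_(m0, n0)).
Variables (v : tq_model) (d : tq_splitting).
Local Notation X := 'M[R]_(m, n).

Definition pixel_sum (phi : R -> R) (x : X) : R :=
  match v with
  | ITQ => \sum_i \sum_j phi (pixnorm x i j)
  | ATQ => \sum_i \sum_j \sum_l phi `|nablal l x i j|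
  end.

Definition data_term (x : X) : R :=
  2^-1 * enorm (@dot R m0 n0) (A x - x0) ^+ 2.

Definition tqF (x : X) : R :=
  data_term x +
  pixel_sum (fun s => mu / 2 * Num.min (s ^+ 2) (lambda / mu)) x.

Definition tqf (x : X) : R :=
  match d with data_in_f => data_term x | data_in_P1 => 0 end.

Definition tqP1 (x : X) : R :=
  let P1 := pixel_sum (fun s => mu / 2 * (s ^+ 2 + lambda / mu)) x in
  match d with data_in_f => P1 | data_in_P1 => data_term x + P1 end.

Definition tqP2 (x : X) : R :=
  pixel_sum (fun s => mu / 2 * Num.max (s ^+ 2) (lambda / mu)) x.

Definition chi (x y : X) : X :=
  \matrix_(i, j) if Num.sqrt (lambda / mu) <= pixnorm x i j then y i j else 0.

Definition chil (l : 'I_2) (x y : X) : X :=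
  \matrix_(i, j)
    if Num.sqrt (lambda / mu) <= `|nablal l x i j| then y i j else 0.

Definition tq_subgradient (x : X) : X :=
  match v with
  | ITQ => mu *: adjoint (@dot2 R m n) (@nabla R m n)
                   (chi x (nabla x).1, chi x (nabla x).2)
  | ATQ => mu *: \sum_(l < 2)
                   adjoint (@dot R m n) (@nablal R m n l) (chil l x (nablal l x))
  end.

End TruncatedQuadratic.

Section Algorithm.
Variables (R : realType) (m n : nat).
Local Notation X := 'M[R]_(m, n).

(* [t.-1] is [0] at [t = 0], which encodes the convention x^{-1} = x^0. *)
Definition extrapolation (beta : nat -> R) (x : nat -> X) (t : nat) : X :=
  x t + beta t *: (x t - x t.-1).

Definition preDCAe (f P1 P2 : X -> R) (M : X -> X) (beta : nat -> R)
    (xi x : nat -> X) : Prop :=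
  [/\ (forall t, 0 <= beta t < 1),
      sup (range beta) < 1,
      (forall t, convex_subdiff P2 (x t) (xi t)) &
      forall t, let y := extrapolation beta x t in
        is_argmin (fun z => dot (gradient f y - xi t) z
                            + 2^-1 * sqnormM M (z - y) + P1 z) (x t.+1)].

(* The potential E(x, y) = F(x) + 1/2 |x - y|_M^2. *)
Definition potential (F : X -> R) (M : X -> X) (z : X * X) : R :=
  F z.1 + 2^-1 * sqnormM M (z.1 - z.2).

End Algorithm.

Section KurdykaLojasiewicz.
Variables (R : realType) (V : normedModType R) (ip : V -> V -> R).

Definition regular_subdiff (h : V -> R) (z : V) : set V :=
  [set xi | (0 <= limf_einf
     (fun w => ((h w - h z - ip xi (w - z)) / enorm ip (w - z))%:E) z^')%E].

Definition limiting_subdiff (h : V -> R) (z : V) : set V :=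
  [set xi | exists zk xik : nat -> V,
     [/\ zk @ \oo --> z, h \o zk @ \oo --> h z, xik @ \oo --> xi &
         forall k, regular_subdiff h (zk k) (xik k)]].

Definition stationary (h : V -> R) (z : V) := limiting_subdiff h z 0.

(* Equal to +oo when [S] is empty. *)
Definition dist0 (S : set V) : \bar R :=
  ereal_inf [set (enorm ip xi)%:E | xi in S].

Definition KL_at (h : V -> R) (psi : R -> R) (zbar : V) :=
  exists2 a : R, 0 < a & exists2 O : set V, nbhs zbar O &
    forall z, O z -> h zbar < h z < h zbar + a ->
      (1 <= (derive1 psi (h z - h zbar))%:E * dist0 (limiting_subdiff h z))%E.

End KurdykaLojasiewicz.

Definition desingularizing (R : realType) (c theta : R) (s : R) : R :=
  c * s `^ (1 - theta).

(* Main.v *)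
Require Import Defs.
From HB Require Import structures.
From mathcomp Require Import all_boot all_order all_algebra.
From mathcomp Require Import all_classical all_reals all_analysis.
From mathcomp Require Import ring lra.
Import Order.TTheory GRing.Theory Num.Theory.
Import numFieldNormedType.Exports.
Local Open Scope classical_set_scope.
Local Open Scope ring_scope.

(** [F] is the pointwise minimum of finitely many convex quadratics [Q_s], one
    for each choice [s] of the pixels that are not truncated.  A nonnegative
    quadratic [q] with Hessian [H] satisfies [q z - q z' <= C |grad q z|^2]
    (test its positivity with a generalized inverse of [H]).  Near any point
    only the pieces active there are active, and a regular subgradient of the
    potential at [z] is the gradient of any piece active at [z]; so the
    inequality passes to the potential and is the KL inequality with exponent
    1/2.  Along the iteration the prescribed subgradient of [P2] is the gradient
    of an active piece; hence optimality bounds [grad Q_s(x^t)] by the last two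
    steps, and with the descent of the potential its gap to the limit contracts
    by a fixed factor every two iterations. *)

(** * The Frobenius inner product *)

Section Dot.
Set Implicit Arguments.
Unset Strict Implicit.
Context {R : realType} {m n : nat}.
Local Notation X := 'M[R]_(m, n).
Implicit Types (x y z w : X) (N : {linear X -> X}).

Lemma dotC x y : dot x y = dot y x.
Proof. by apply: eq_bigr => i _; apply: eq_bigr => j _; rewrite mulrC. Qed.

Lemma dotDl x y z : dot (x + y) z = dot x z + dot y z.
Proof.
rewrite /dot -big_split; apply: eq_bigr => i _; rewrite -big_split.
by apply: eq_bigr => j _; rewrite mxE mulrDl.
Qed.

Lemma dotZl a x y : dot (a *: x) y = a * dot x y.
Proof.
rewrite /dot mulr_sumr; apply: eq_bigr => i _; rewrite mulr_sumr.
by apply: eq_bigr => j _; rewrite mxE mulrA.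
Qed.

Lemma dotDr x y z : dot x (y + z) = dot x y + dot x z.
Proof. by rewrite dotC dotDl !(dotC x). Qed.

Lemma dotZr a x y : dot x (a *: y) = a * dot x y.
Proof. by rewrite dotC dotZl dotC. Qed.

Lemma dotNl x y : dot (- x) y = - dot x y.
Proof. by rewrite -scaleN1r dotZl mulN1r. Qed.

Lemma dotNr x y : dot x (- y) = - dot x y.
Proof. by rewrite dotC dotNl dotC. Qed.

Lemma dot0l x : dot 0 x = 0.
Proof. by rewrite -(scale0r 0) dotZl mul0r. Qed.

Lemma dot0r x : dot x 0 = 0.
Proof. by rewrite dotC dot0l. Qed.

Definition dotE := (dotDl, dotDr, dotNl, dotNr, dotZl, dotZr).

Lemma dot_ge0 x : 0 <= dot x x.
Proof. by do 2!apply: sumr_ge0 => ? _; rewrite -expr2 sqr_ge0. Qed.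

Lemma dot_eq0 x : dot x x = 0 -> x = 0.
Proof.
have ge0 i j : 0 <= x i j * x i j by rewrite -expr2 sqr_ge0.
move=> /(psumr_eq0P (fun i _ => sumr_ge0 _ (fun j _ => ge0 i j))) x0.
apply/matrixP => i j; have /(psumr_eq0P (fun j _ => ge0 i j)) := x0 i isT.
by move=> /(_ j isT)/eqP; rewrite mxE mulf_eq0 orbb => /eqP.
Qed.

Lemma dot_inj x y : (forall w, dot x w = dot y w) -> x = y.
Proof.
move=> xy; apply/eqP; rewrite -subr_eq0; apply/eqP/dot_eq0.
by rewrite {1}dotDl dotNl xy subrr.
Qed.

Lemma dot_CauchySchwarz x y : dot x y ^+ 2 <= dot x x * dot y y.
Proof.
have [y0|y0] := eqVneq (dot y y) 0.
  by rewrite (dot_eq0 y0) dot0r dot0l expr0n mulr0.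
have yy : 0 < dot y y by rewrite lt_def y0 dot_ge0.
have := dot_ge0 (dot y y *: x - dot x y *: y).
rewrite !dotE (dotC y x) => h; rewrite -(ler_pM2l yy) -subr_ge0.
by apply: le_trans h _; lra.
Qed.

Lemma dot_triangle2 x y : dot (x + y) (x + y) <= 2 * dot x x + 2 * dot y y.
Proof. by have := dot_ge0 (x - y); rewrite !dotE (dotC y x); lra. Qed.

Lemma enormK x : enorm (@dot R m n) x ^+ 2 = dot x x.
Proof. by rewrite sqr_sqrtr // dot_ge0. Qed.

Lemma enorm_ge0 x : 0 <= enorm (@dot R m n) x.
Proof. exact: sqrtr_ge0. Qed.

Lemma dot_le_enorm x y :
  `|dot x y| <= enorm (@dot R m n) x * enorm (@dot R m n) y.
Proof.
rewrite -[leLHS]ger0_norm // -ler_sqr ?nnegrE ?normr_ge0 //; last first.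
  by rewrite mulr_ge0 ?enorm_ge0.
rewrite normr_id exprMn !enormK real_normK ?num_real //.
exact: dot_CauchySchwarz.
Qed.

Lemma enormD x y : enorm (@dot R m n) (x + y) <=
  enorm (@dot R m n) x + enorm (@dot R m n) y.
Proof.
rewrite -ler_sqr ?nnegrE ?addr_ge0 ?enorm_ge0 // enormK !dotE (dotC y x).
rewrite sqrrD !enormK; have := dot_le_enorm x y; have := ler_norm (dot x y).
by lra.
Qed.

Lemma linear_functional (g : {linear X -> R^o}) : exists a, forall x, g x = dot x a.
Proof.
exists (adjoint (fun u v : R => u * v) g 1) => x.
rewrite (@adjointP R m n R^o) ?mulr1 //; first by move=> a u v; rewrite linearP.
by move=> a u v; rewrite mulrDl mulrA.
Qed.

(** Each entry of [N x] is a scalar product with a fixed matrix [a i j], so Cauchy-Schwarz bounds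
    its square; the added 1 makes the constant positive even when [N] vanishes. *)
Lemma linear_bounded N : exists2 C, 0 < C & forall x, dot (N x) (N x) <= C * dot x x.
Proof.
have lin i j : linear (fun x => N x i j : R^o) by move=> a u v; rewrite linearP !mxE.
pose Nf i j : {linear X -> R^o} :=
  HB.pack (fun x => N x i j : R^o) (GRing.isLinear.Build _ _ _ _ _ (lin i j)).
have [a aP] : exists a : 'I_m -> 'I_n -> X, forall i j x, N x i j = dot x (a i j).
  have /choice[a aP] : forall p : 'I_m * 'I_n, exists a, forall x, N x p.1 p.2 = dot x a.
    by move=> [i j]; have [b bP] := linear_functional (Nf i j); exists b.
  by exists (fun i j => a (i, j)) => i j x; rewrite (aP (i, j)).
exists (1 + \sum_i \sum_j dot (a i j) (a i j)).
  by rewrite ltr_pwDl // sumr_ge0 // => i _; rewrite sumr_ge0 // => j _; rewrite dot_ge0.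
move=> x; rewrite mulrDl mul1r -[leLHS]add0r lerD ?dot_ge0 // mulr_suml.
apply: ler_sum => i _; rewrite mulr_suml; apply: ler_sum => j _.
by rewrite -expr2 aP mulrC dot_CauchySchwarz.
Qed.

Lemma linear_form_bounded N : exists2 C, 0 < C & forall x, dot (N x) x <= C * dot x x.
Proof.
have [C C0 NC] := linear_bounded N; exists (C + 1); first by rewrite addr_gt0.
move=> x; have := dot_ge0 (N x - x); have := NC x; have := dot_ge0 x.
have := dot_ge0 (N x).
rewrite !dotE (dotC x (N x)); nra.
Qed.

Lemma cvg_coord {T} (F : set_system T) {FF : Filter F} (f : T -> X) x i j :
  f @ F --> x -> f t i j @[t --> F] --> x i j.
Proof.
move=> fx; have := @coord_continuous R m n i j x.
exact: (cvg_comp _ (fun M : X => M i j) fx).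
Qed.

Lemma cvg_dot {T} (F : set_system T) {FF : Filter F} (f g : T -> X) x y :
  f @ F --> x -> g @ F --> y -> dot (f t) (g t) @[t --> F] --> dot x y.
Proof.
move=> fx gy; apply: cvg_big => [|i _]; first exact: add_continuous.
apply: cvg_big => [|j _]; first exact: add_continuous.
by apply: cvgM; apply: cvg_coord.
Qed.

Lemma cvg_enorm {T} (F : set_system T) {FF : Filter F} (f : T -> X) x :
  f @ F --> x -> enorm (@dot R m n) (f t) @[t --> F] --> enorm (@dot R m n) x.
Proof.
move=> fx; have := @sqrt_continuous R (dot x x).
exact: (cvg_comp _ (@Num.sqrt R) (cvg_dot fx fx)).
Qed.

Lemma cvg_linear {T} (F : set_system T) {FF : Filter F} N (f : T -> X) x :
  f @ F --> x -> N (f t) @[t --> F] --> N x.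
Proof.
move=> fx.
have NE z : N z = \sum_i \sum_j z i j *: N (delta_mx i j).
  rewrite {1}(matrix_sum_delta z) linear_sum; apply: eq_bigr => i _.
  by rewrite linear_sum; apply: eq_bigr => j _; rewrite linearZ.
rewrite NE; under eq_cvg do rewrite NE.
apply: cvg_big => [|i _]; first exact: add_continuous.
apply: cvg_big => [|j _]; first exact: add_continuous.
by apply: cvgZr_tmp; apply: cvg_coord.
Qed.

End Dot.

(** * Quadratic functions *)

Section Quadratic.
Set Implicit Arguments.
Unset Strict Implicit.
Context {R : realType} {m n : nat}.
Local Notation X := 'M[R]_(m, n).
Implicit Types (x y z w h : X) (q : X -> R) (H : {linear X -> X}).

(** [h] is the gradient at 0 and [H] the Hessian; self-adjointness makes [h + H x] the gradient at
    [x]. *)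
Definition quadratic q h H := self_adjoint H /\
  forall x, q x = q 0 + dot h x + 2^-1 * dot x (H x).

Lemma quadraticD q1 h1 H1 q2 h2 H2 : quadratic q1 h1 H1 -> quadratic q2 h2 H2 ->
  quadratic (fun x => q1 x + q2 x) (h1 + h2) (H1 \+ H2).
Proof.
move=> [s1 e1] [s2 e2]; split=> [x y|x] /=; first by rewrite !dotE s1 s2.
by rewrite e1 e2 !dotE; ring.
Qed.

Lemma quadraticB q1 h1 H1 q2 h2 H2 : quadratic q1 h1 H1 -> quadratic q2 h2 H2 ->
  quadratic (fun x => q1 x - q2 x) (h1 - h2) (H1 \- H2).
Proof.
move=> [s1 e1] [s2 e2]; split=> [x y|x] /=; first by rewrite !dotE s1 s2.
by rewrite e1 e2 !dotE; ring.
Qed.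

Lemma quadratic_affine (c : R) h : quadratic (fun x => c + dot h x) h \0.
Proof.
split=> [x y|x] /=; first by rewrite dot0l dot0r.
by rewrite !dot0r; ring.
Qed.

Lemma quadratic_form (c : R) H : self_adjoint H ->
  quadratic (fun x => c + 2^-1 * dot x (H x)) 0 H.
Proof. by move=> s; split=> // x; rewrite !dot0l; ring. Qed.

Lemma quadratic_ext q1 q2 h H : (forall x, q1 x = q2 x) ->
  quadratic q1 h H -> quadratic q2 h H.
Proof. by move=> e [s qE]; split=> // x; rewrite -!e. Qed.

Lemma quadratic_shift q h H x w : quadratic q h H ->
  q (x + w) = q x + dot (h + H x) w + 2^-1 * dot w (H w).
Proof.
move=> [s e]; rewrite e (e x) linearD !dotE (dotC w (H x)) -(s x w).
by field.
Qed.

Lemma quadratic_cvg {T} (F : set_system T) {FF : Filter F} (f : T -> X) x q h H :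
  quadratic q h H -> f @ F --> x -> q (f t) @[t --> F] --> q x.
Proof.
move=> [_ e] fx; rewrite e; under eq_cvg do rewrite e.
apply: cvgD; first by apply: cvgD; [exact: cvg_cst|apply: cvg_dot => //; exact: cvg_cst].
apply: cvgM; first exact: cvg_cst.
by apply: cvg_dot => //; exact: cvg_linear.
Qed.

Lemma scalar_quadratic_ge0 (a b c : R) : (forall t, 0 <= c + t * b + t ^+ 2 * a) ->
  0 <= a /\ (a = 0 -> b = 0).
Proof.
move=> ge0; have c0 : 0 <= c by have := ge0 0; rewrite expr0n /= !mul0r !addr0.
split.
  (* Here [t >= 1] and [t * a <= - (c + 1)], so the values at [t] and [- t] have a negative sum. *)
  rewrite leNgt; apply/negP => a0; pose t := (c + 1) / (- a) + 1.
  have ta : (c + 1) / (- a) * a = - (c + 1) by field; apply: ltr0_neq0.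
  have t0 : 0 <= (c + 1) / (- a) by rewrite divr_ge0 //; lra.
  have := ge0 t; have := ge0 (- t); rewrite /t; nra.
move=> a0; apply/eqP/negPn/negP => b0.
have := ge0 (- (c + 1) / b); rewrite a0 divfK //; lra.
Qed.

Lemma quadratic_ge0_psd q h H : quadratic q h H -> (forall x, 0 <= q x) ->
  forall w, 0 <= dot w (H w) /\ (dot w (H w) = 0 -> dot h w = 0).
Proof.
move=> [_ e] q0 w; have := @scalar_quadratic_ge0 (2^-1 * dot w (H w)) (dot h w) (q 0).
case=> [t|a0 b0].
  have := q0 (t *: w); rewrite e linearZ !dotE; congr (0 <= _); ring.
split; first by rewrite pmulr_rge0 in a0.
by move=> wHw; apply: b0; rewrite wHw mulr0.
Qed.

Lemma quadratic_argmin q h H x : quadratic q h H -> is_argmin q x -> h + H x = 0.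
Proof.
move=> Q min; apply: dot_eq0.
set g := h + H x.
have ge0 t : 0 <= 0 + t * dot g g + t ^+ 2 * (2^-1 * dot g (H g)).
  have := min (x + t *: g); rewrite (quadratic_shift _ _ Q) linearZ !dotE -/g; lra.
have [//|g0] := eqVneq (dot g g) 0.
have gg : 0 < dot g g by rewrite lt_def g0 dot_ge0.
set a := 2^-1 * dot g (H g) in ge0; have [a0 _] := scalar_quadratic_ge0 ge0.
have a1 : 0 < a + 1 by lra.
(* With this step along [- g] the second-order term [s ^+ 2 * a] stays below the first-order
   decrease [s * dot g g = 2 * s ^+ 2 * (a + 1)]. *)
pose s := dot g g / (2 * (a + 1)).
have s0 : 0 < s by rewrite divr_gt0 // mulr_gt0.
have gE : dot g g = s * (2 * (a + 1)) by rewrite divfK // gt_eqF // mulr_gt0.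
have := ge0 (- s); rewrite gE; nra.
Qed.

Lemma quadratic_derive q h H x w : quadratic q h H -> 'D_w q x = dot (h + H x) w.
Proof.
move=> Q; apply: cvg_lim; first exact: Rhausdorff.
have : dot (h + H x) w + t * (2^-1 * dot w (H w)) @[t --> 0^'] -->
    dot (h + H x) w + 0 * (2^-1 * dot w (H w)).
  apply: cvgD; first exact: cvg_cst.
  apply: cvgM; last exact: cvg_cst.
  exact: nbhs_dnbhs.
rewrite mul0r addr0; apply: cvg_trans; apply: near_eq_cvg.
near=> t; have t0 : t != 0 by near: t; exact: nbhs_dnbhs_neq.
rewrite /= [t *: w + x]addrC (quadratic_shift _ _ Q) linearZ !dotE.
rewrite /GRing.scale /=; by field.
Unshelve. all: by end_near.
Qed.

Lemma quadratic_gradient q h H x : quadratic q h H -> gradient q x = h + H x.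
Proof.
move=> Q; apply/matrixP => i j; rewrite mxE (quadratic_derive _ _ Q).
rewrite /dot (bigD1 i) //= (bigD1 j) //= !big1 ?addr0.
- by rewrite [delta_mx _ _ _ _]mxE !eqxx mulr1.
- move=> k ki; rewrite big1 // => l _.
  by rewrite [delta_mx _ _ _ _]mxE (negPf ki) mulr0.
- by move=> k ki; rewrite [delta_mx _ _ _ _]mxE (negPf ki) andbF mulr0.
Qed.

(** The gradients at [w] and at 0 differ by [H w]; Cauchy-Schwarz turns the Lipschitz bound into one
    on the quadratic form. *)
Lemma lipschitz_hessian q h H L w :
  quadratic q h H -> lipschitz_constant (gradient q) L -> dot w (H w) <= L * dot w w.
Proof.
move=> Q [[L0 lip] _]; have := lip w 0.
rewrite !(quadratic_gradient _ Q) linear0 addr0 [h + _]addrC addrK subr0 => le.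
apply: le_trans (ler_norm _) _; apply: le_trans (dot_le_enorm _ _) _.
rewrite -enormK expr2 mulrA [leRHS]mulrC ler_wpM2l //; exact: enorm_ge0.
Qed.

End Quadratic.

(** * Gradient domination for nonnegative quadratics *)

Section GradientDomination.
Set Implicit Arguments.
Unset Strict Implicit.
Context {R : realType} {m n : nat}.
Local Notation X := 'M[R]_(m, n).
Implicit Types (x y z w h : X) (q : X -> R) (H : {linear X -> X}).

Lemma dot_mxvec x y : (mxvec x *m (mxvec y)^T) 0 0 = dot x y.
Proof.
rewrite /dot pair_bigA mxE (reindex _ (curry_mxvec_bij _ _)) /=.
by apply: eq_bigr => -[i j] _; rewrite mxE !mxvecE.
Qed.

(* A nonnegative [q] cannot be affine and nonconstant on the kernel of [H]. *)
Lemma quadratic_gradient_range q h H z : quadratic q h H -> (forall x, 0 <= q x) ->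
  (mxvec (h + H z) <= lin_mx H)%MS.
Proof.
move=> Q q0; have [sH _] := Q.
rewrite linearD addmx_sub //=; last by rewrite -mul_vec_lin submxMl.
rewrite submxE; apply/eqP/matrixP => i j; rewrite ord1 [RHS]mxE.
(* Membership in the row space is tested on the cokernel columns. Each one, reshaped to [k'], lies
   in the kernel of [H] by self-adjointness, and positivity of [q] then forces [dot h k' = 0]. *)
set k := col j (cokermx (lin_mx H)).
have Hk : lin_mx H *m k = 0 by rewrite /k colE mulmxA mulmx_coker mul0mx.
pose k' : X := vec_mx k^T.
have dk x : dot x k' = (mxvec x *m k) 0 0 by rewrite -dot_mxvec vec_mxK trmxK.
have Hk' : H k' = 0.
  by apply: dot_inj => w; rewrite dot0l sH dotC dk -mul_vec_lin -mulmxA Hk mulmx0 mxE.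
have [_] := quadratic_ge0_psd Q q0 k'; rewrite Hk' dot0r => /(_ erefl).
by rewrite dk /k colE mulmxA -colE mxE.
Qed.

Lemma gradient_domination q h H : quadratic q h H -> (forall x, 0 <= q x) ->
  exists2 C, 0 < C & forall z z', q z - q z' <= C * dot (h + H z) (h + H z).
Proof.
move=> Q q0; have [sH _] := Q.
(* [N] is a generalized inverse: [H (N u) = u] for every [u] in the range of [H]. *)
pose N u : X := vec_mx (mxvec u *m pinvmx (lin_mx H)).
have linN : linear N by move=> a u v; rewrite /N linearP mulmxDl -scalemxAl linearP.
pose N' : {linear X -> X} := HB.pack N (GRing.isLinear.Build _ _ _ _ _ linN).
have [C C0 /= CN] := linear_form_bounded N'; clear N' linN.
exists C => // z z'; have rg := quadratic_gradient_range z Q q0.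
have -> : q z' = q (z + (z' - z)) by rewrite addrC subrK.
rewrite (quadratic_shift _ _ Q).
move: (h + H z) (z' - z) rg => g w rg.
have HN : H (N g) = g by rewrite -[LHS]mxvecK -mul_vec_lin vec_mxK (mulmxKpV rg) mxvecK.
(* Expanded, [dot (N g) g + 2 * dot g w + dot w (H w)] is nonnegative, so the decrease
   [- dot g w - 2^-1 * dot w (H w)] is at most [2^-1 * dot (N g) g]. *)
have [+ _] := quadratic_ge0_psd Q q0 (N g + w).
rewrite linearD HN !dotE -(sH (N g) w) HN (dotC w g).
by have := CN g; have := mulr_ge0 (ltW C0) (dot_ge0 g); lra.
Qed.

End GradientDomination.

(** * The KL inequality for a minimum of quadratics *)

Section RegularSubgradient.
Set Implicit Arguments.
Unset Strict Implicit.
Context {R : realType}.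

(** [limf_einf] is the opposite of the infimum, over the sets of the filter, of the suprema of
    [- phi]; each of these suprema is at least [r]. *)
Lemma limf_einf_lt0 (T : topologicalType) (phi : T -> \bar R) (F : set_system T) (r : R) :
  0 < r -> (forall V, F V -> exists2 w, V w & (phi w <= (- r)%:E)%E) ->
  ~ (0 <= limf_einf phi F)%E.
Proof.
move=> r0 H; rewrite /limf_einf /= leeNr oppe0 => le0.
suff : (r%:E <= 0)%E by rewrite lee_fin leNgt r0.
apply: le_trans le0; apply: le_ereal_inf_tmp => _ [V FV <-].
have [w Vw phiw] := H V FV.
apply: (@le_trans _ _ (- phi w)%E); first by rewrite leeNr -EFinN.
by apply: ereal_sup_ubound; exists w.
Qed.

Context {m n : nat}.
Local Notation X := 'M[R]_(m, n).

Lemma dot2_ge0 (p : X * X) : 0 <= dot2 p p.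
Proof. by rewrite addr_ge0 ?dot_ge0. Qed.

(** Since [q] touches [F] from above at [z.1], a regular subgradient of the potential is also one of
    the smooth function with [q] in place of [F], hence is its gradient. *)
Lemma regular_subdiff_active (F q : X -> R) (h : X) (H M : {linear X -> X})
    (z xi : X * X) :
  quadratic q h H -> self_adjoint M -> (forall x, F x <= q x) -> F z.1 = q z.1 ->
  regular_subdiff (@dot2 R m n) (potential F M) z xi ->
  xi = (h + H z.1 + M (z.1 - z.2), - M (z.1 - z.2)).
Proof.
move=> Q sM Fq Fz reg.
(* Test the subgradient inequality along the ray [z + t *: (xi - g)].  The
   abbreviations are opaque: [rewrite !dotE] would unfold a [set] body. *)
have [g gE] : exists g, g = (h + H z.1 + M (z.1 - z.2), - M (z.1 - z.2)) by eexists.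
rewrite -gE; have [de deE] : exists de, xi = g + de by exists (xi - g); rewrite addrC subrK.
suff de0 : dot2 de de = 0.
  have := dot_ge0 de.1; have := dot_ge0 de.2; move: (de0); rewrite /dot2 => d0 d2 d1.
  have /dot_eq0 e1 : dot de.1 de.1 = 0 by lra.
  have /dot_eq0 e2 : dot de.2 de.2 = 0 by lra.
  by rewrite deE [de]surjective_pairing e1 e2; exact: addr0.
apply/eqP/negPn/negP => de0.
have dd : 0 < dot2 de de by rewrite lt_def de0 dot2_ge0.
have [N NE] : exists N, N = enorm (@dot2 R m n) de by eexists.
have N0 : 0 < N by rewrite NE sqrtr_gt0.
have NN : N ^+ 2 = dot2 de de by rewrite NE sqr_sqrtr // ltW.
(* [K] is the second-order coefficient of that smooth majorant along [de]. *)
have [K KE] : exists K, K =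
  2^-1 * dot de.1 (H de.1) + 2^-1 * dot (de.1 - de.2) (M (de.1 - de.2)) by eexists.
apply: (limf_einf_lt0 _ _ reg); first exact: (divr_gt0 N0 (ltr0Sn _ 1)).
move=> V zV.
have cv : z + t *: de @[t --> (0:R)^'+] --> z.
  rewrite -[X in _ --> X]addr0 -(scale0r de); apply: cvgD; first exact: cvg_cst.
  by apply: cvgZr_tmp; exact: cvg_within.
have nV := cv _ zV.
(* For such [t] the term [t ^+ 2 * K] is at most half of [t * N ^+ 2], so the difference quotient
   along the ray is at most [- (N / 2)]. *)
have : \forall t \near (0:R)^'+,
  [/\ z + t *: de != z -> V (z + t *: de), 0 < t & t < N ^+ 2 / (2 * (`|K| + 1))].
  near=> t; split.
  - by near: t; exact: nV.
  - by near: t; exact: nbhs_right_gt.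
  - by near: t; apply: nbhs_right_lt; rewrite divr_gt0 ?exprn_gt0 ?mulr_gt0 ?ltr_wpDl.
move=> /filter_ex[t [Vt t0 tK]].
exists (z + t *: de).
  apply: Vt; rewrite -subr_eq0 addrC addKr scaler_eq0 gt_eqF //=.
  by apply: contraNneq de0 => ->; rewrite /dot2 /= dot0l addr0.
have -> : z + t *: de - z = t *: de by rewrite addrC addKr.
have -> : enorm (@dot2 R m n) (t *: de) = t * N.
  rewrite /enorm /dot2 /= !dotE -!mulrDr -/(dot2 de de) mulrA -expr2.
  by rewrite sqrtrM ?sqr_ge0 // sqrtr_sqr gtr0_norm // NE.
have tN : 0 < t * N by rewrite mulr_gt0.
rewrite lee_fin ler_pdivrMr //.
have Ew : potential F M (z + t *: de) <=
    potential F M z + t * dot2 g de + t ^+ 2 * K.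
  rewrite /potential /=.
  have -> : z.1 + t *: de.1 - (z.2 + t *: de.2) = (z.1 - z.2) + t *: (de.1 - de.2).
    by rewrite scalerBr opprD addrACA.
  rewrite /sqnormM Fz; apply: le_trans (lerD (Fq _) (lexx _)) _.
  rewrite (quadratic_shift _ _ Q) KE gE /dot2 /=.
  move: (z.1 - z.2) => u; move e'E: (de.1 - de.2) => e'.
  rewrite [dot (h + _ + _) _]dotDl.
  move: (h + H z.1) => e.
  have dM : dot (M u) de.1 - dot (M u) de.2 = dot u (M e').
    by rewrite -sM -e'E dotDr dotNr.
  have Mu : dot e' (M u) = dot u (M e') by rewrite dotC sM.
  rewrite !linearD !linearZ !dotE Mu -dM le_eqVlt; apply/orP; left.
  by apply/eqP; field.
have xiE : dot2 xi (t *: de) = t * dot2 g de + t * N ^+ 2.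
  by rewrite deE NN /dot2 /= !dotE; ring.
rewrite xiE; have K1 : 0 < 2 * (`|K| + 1) by rewrite mulr_gt0 // ltr_wpDl.
move: tK; rewrite ltr_pdivlMr // => tK.
have tt : 0 < t * (N ^+ 2 - t * (2 * (`|K| + 1))) by rewrite mulr_gt0 // subr_gt0.
have tk : 0 <= t ^+ 2 * (`|K| - K) by rewrite mulr_ge0 ?sqr_ge0 // subr_ge0 ler_norm.
have := sqr_ge0 t; lra.
Unshelve. all: by end_near.
Qed.

End RegularSubgradient.

(** * Minima of finitely many quadratics and their potentials *)

Section MinOfQuadratics.
Set Implicit Arguments.
Unset Strict Implicit.
Context {R : realType} {m n : nat} {S : finType}.
Local Notation X := 'M[R]_(m, n).
Implicit Types (F : X -> R) (Q : S -> X -> R) (h : S -> X) (H : S -> {linear X -> X}).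

(** Nonnegativity of [F] passes to every piece [Q s], as gradient domination requires. *)
Definition min_of_quadratics F Q h H :=
  [/\ forall s, quadratic (Q s) (h s) (H s), forall s x, F x <= Q s x,
      forall x, exists s, F x = Q s x & forall x, 0 <= F x].

Lemma min_gradient_domination F Q h H : min_of_quadratics F Q h H ->
  exists2 C, 0 < C & forall s z z',
    Q s z - Q s z' <= C * dot (h s + H s z) (h s + H s z).
Proof.
move=> [quadQ FQ _ F0].
have /choice[C HC] : forall s, exists C, 0 < C /\ forall z z',
    Q s z - Q s z' <= C * dot (h s + H s z) (h s + H s z).
  move=> s; have [C C0 HC] := gradient_domination (quadQ s) (fun x => le_trans (F0 x) (FQ s x)).
  by exists C.
exists (1 + \sum_s C s).
  by rewrite ltr_pwDl // sumr_ge0 // => s _; rewrite ltW //; case: (HC s).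
move=> s z z'; apply: le_trans (proj2 (HC s) z z') _; rewrite ler_wpM2r ?dot_ge0 //.
rewrite (bigD1 s) //= addrCA lerDl addr_ge0 // sumr_ge0 // => k _.
by rewrite ltW //; case: (HC k).
Qed.

(** A piece inactive at [xbar] is strictly above an active one there, and by continuity also nearby,
    where it cannot equal [F]. Finitely many pieces leave a common neighbourhood. *)
Lemma near_active F Q h H xbar : min_of_quadratics F Q h H ->
  \forall x \near xbar, forall s, F x = Q s x -> F xbar = Q s xbar.
Proof.
move=> [quadQ FQ act _]; have [s0 Fs0] := act xbar.
suff near_s s : \forall x \near xbar, F x = Q s x -> F xbar = Q s xbar.
  exact: (@filter_forall X S (fun s x => F x = Q s x -> F xbar = Q s xbar) (nbhs xbar) _ near_s).
have [Fs|Fs] := eqVneq (F xbar) (Q s xbar); first by near=> x.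
have lt0 : 0 < Q s xbar - Q s0 xbar by rewrite -Fs0 subr_gt0 lt_def eq_sym Fs FQ.
have : (fun x => Q s x - Q s0 x) x @[x --> xbar] --> Q s xbar - Q s0 xbar.
  have cvQ k : Q k x @[x --> nbhs xbar] --> Q k xbar.
    exact: (@quadratic_cvg R m n X (nbhs xbar) (nbhs_filter xbar) id xbar _ _ _ (quadQ k) cvg_id).
  exact: (@cvgB _ _ X (nbhs xbar) (nbhs_filter xbar) _ _ _ _ (cvQ s) (cvQ s0)).
move=> /(cvgr_gt _)/(_ 0 lt0) near0.
near=> x; have : 0 < Q s x - Q s0 x by near: x; exact: near0.
by rewrite subr_gt0 => Qlt FQx; have := FQ s0 x; rewrite FQx leNgt Qlt.
Unshelve. all: by end_near.
Qed.

(** The subgradient is [(g + M u, - M u)], with [g] the gradient of an active piece and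
    [u = z.1 - z.2]. Its two components control [g], hence the gap of that piece, and also the
    quadratic term of the potential. *)
Lemma potential_gap F Q h H (M : {linear X -> X}) L0 : min_of_quadratics F Q h H ->
  self_adjoint M -> loewner_ge M L0 -> 0 < L0 ->
  exists2 C, 0 < C & forall zbar z xi : X * X,
    (forall s, F z.1 = Q s z.1 -> F zbar.1 = Q s zbar.1) ->
    regular_subdiff (@dot2 R m n) (potential F M) z xi ->
    potential F M z - potential F M zbar <= C * dot2 xi xi.
Proof.
move=> minF sM ML0 L0_gt0; have [C C0 HC] := min_gradient_domination minF.
have [quadQ FQ act _] := minF.
exists (2 * C + L0^-1); first by rewrite addr_gt0 ?mulr_gt0 ?invr_gt0.
move=> zbar z xi local reg; have [s Fs] := act z.1.
have -> := regular_subdiff_active (quadQ s) sM (FQ s) Fs reg.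
rewrite /potential Fs (local _ Fs) /dot2 /=.
have := HC s z.1 zbar.1.
move: (h s + H s z.1) => g HCg; move uE: (z.1 - z.2) => u.
have Mbar : 0 <= sqnormM M (zbar.1 - zbar.2).
  by apply: le_trans (ML0 _); rewrite mulr_ge0 ?dot_ge0 // ltW.
(* Expand the squared norm of [M u - L0 *: u] and bound [L0 * dot u u] by [dot u (M u)]. *)
have uMu : sqnormM M u <= L0^-1 * dot (M u) (M u).
  rewrite -(ler_pM2l L0_gt0) mulVKf ?gt_eqF // /sqnormM.
  have := dot_ge0 (M u - L0 *: u); have := ML0 u.
  rewrite !dotE (dotC u (M u)) => h1.
  have : L0 * (L0 * dot u u) <= L0 * dot (M u) u by rewrite ler_pM2l.
  lra.
have := dot_triangle2 (g + M u) (- M u); rewrite addrK.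
have := dot_ge0 (M u); have := dot_ge0 (g + M u); rewrite dotNl dotNr opprK.
move: (dot (g + M u) (g + M u)) => a a0.
move: (dot (M u) (M u)) uMu => b uMu b0 gab.
have : C * dot g g <= C * (2 * a + 2 * b) by rewrite ler_pM2l.
have : 0 <= L0^-1 * a by rewrite mulr_ge0 // invr_ge0 ltW.
have : 0 <= L0^-1 * b by rewrite mulr_ge0 // invr_ge0 ltW.
lra.
Qed.

(** Both sides pass to the limit: limiting subgradients come with convergence of the function
    values, not only of the points. *)
Lemma limiting_gap F (M : {linear X -> X}) (O : set (X * X)) C E0 z xi :
  (forall w eta, O w -> regular_subdiff (@dot2 R m n) (potential F M) w eta ->
     potential F M w - E0 <= C * dot2 eta eta) ->
  nbhs z O -> limiting_subdiff (@dot2 R m n) (potential F M) z xi ->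
  potential F M z - E0 <= C * dot2 xi xi.
Proof.
move=> HO zO [zk [xik [zkz Ekz xikxi reg]]].
have cE : potential F M (zk k) - E0 @[k --> \oo] --> potential F M z - E0.
  by apply: cvgB; [exact: Ekz|exact: cvg_cst].
have cxi : C * dot2 (xik k) (xik k) @[k --> \oo] --> C * dot2 xi xi.
  apply: cvgM; first exact: cvg_cst.
  have c1 : (xik k).1 @[k --> \oo] --> xi.1.
    have := cvg_comp xik fst xikxi; apply.
    exact: (@cvg_fst _ _ (nbhs xi.1) (nbhs xi.2) _).
  have c2 : (xik k).2 @[k --> \oo] --> xi.2.
    have := cvg_comp xik snd xikxi; apply.
    exact: (@cvg_snd _ _ (nbhs xi.1) (nbhs xi.2) _).
  by apply: cvgD; apply: cvg_dot.
apply: (ler_cvg_to cE cxi); near=> k.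
by apply: HO (reg k); near: k; exact: zkz.
Unshelve. all: by end_near.
Qed.

Lemma derive_desingularizing (c s : R) : 0 < s ->
  derive1 (desingularizing c 2^-1) s = c / 2 / Num.sqrt s.
Proof.
move=> s0; rewrite derive1E.
have := is_deriveZ c (is_derive1_powR (1 - 2^-1) s0) => -[_].
rewrite -[LHS]/('D_1 (desingularizing c 2^-1) s) => ->.
have -> : 1 - 2^-1 - 1 = - 2^-1 :> R by ring.
rewrite powRN powR12_sqrt ?ltW // /GRing.scale /=; field.
by rewrite sqrtr_eq0 -ltNge.
Qed.

Lemma potential_KL F Q h H (M : {linear X -> X}) L0 zbar : min_of_quadratics F Q h H ->
  self_adjoint M -> loewner_ge M L0 -> 0 < L0 ->
  exists2 c, 0 < c & KL_at (@dot2 R m n) (potential F M) (desingularizing c 2^-1) zbar.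
Proof.
move=> minF sM ML0 L0_gt0.
have [C C0 HC] := potential_gap minF sM ML0 L0_gt0.
(* With this constant the desingularizing function has derivative [Num.sqrt C / Num.sqrt s], and the
   KL inequality is the square root of the gap bound. *)
exists (2 * Num.sqrt C); first by rewrite mulr_gt0 // sqrtr_gt0.
pose O := [set z : X * X | forall s, F z.1 = Q s z.1 -> F zbar.1 = Q s zbar.1].
have zO : nbhs zbar O.
  exact: (@cvg_fst _ _ (nbhs zbar.1) (nbhs zbar.2) _ _ (near_active zbar.1 minF)).
(* A limiting subgradient at [z] is approximated from points near [z], which must lie in [O] too;
   hence the interior. *)
exists 1 => //; exists O^°; first exact: nbhs_interior zO.
move=> z Oz /andP[lt_z _].
have gap_gt0 : 0 < potential F M z - potential F M zbar by rewrite subr_gt0.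
rewrite derive_desingularizing //; set e := _ - _ in gap_gt0 *.
have -> : 2 * Num.sqrt C / 2 / Num.sqrt e = Num.sqrt C / Num.sqrt e.
  by field; rewrite sqrtr_eq0 -ltNge.
rewrite -lee_pdivrMl ?divr_gt0 ?sqrtr_gt0 // mule1.
apply: le_ereal_inf_tmp => _ [xi zxi <-]; rewrite lee_fin invf_div.
rewrite ler_pdivrMr ?sqrtr_gt0 // [leRHS]mulrC /enorm -sqrtrM ?(ltW C0) // ler_sqrt.
  apply: limiting_gap zxi; last exact: Oz.
  by move=> w eta Ow; exact: HC.
by rewrite mulr_ge0 ?dot2_ge0 // ltW.
Qed.

End MinOfQuadratics.

(** * Linear convergence *)

Section LinearRate.
Set Implicit Arguments.
Unset Strict Implicit.
Context {R : realType}.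

(** The recursion links indices of equal parity, so [B] has to cover the two starting values, at [T]
    and [T.+1]. *)
Lemma two_step_decay (D : nat -> R) r T : 0 < r -> (forall t, 0 <= D t) ->
  (forall t, (T <= t)%N -> D t.+2 <= r ^+ 2 * D t) ->
  exists2 B, 0 < B & forall t, (T <= t)%N -> D t <= B * r ^+ t.
Proof.
move=> r0 D0 dec; exists (1 + D T / r ^+ T + D T.+1 / r ^+ T.+1).
  by rewrite !ltr_wpDr // divr_ge0 // exprn_ge0 // ltW.
set B := _ + _.
have bound t : D t / r ^+ t <= B -> D t <= B * r ^+ t by rewrite ler_pdivrMr // exprn_gt0.
have nn t : 0 <= D t / r ^+ t by rewrite divr_ge0 // exprn_ge0 // ltW.
suff ind k : D (T + k)%N <= B * r ^+ (T + k) /\ D (T + k).+1 <= B * r ^+ (T + k).+1.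
  by move=> t Tt; rewrite -(subnKC Tt); case: (ind (t - T)%N).
elim: k => [|k [IH1 IH2]].
  rewrite addn0; split; apply: bound; rewrite /B; have := nn T; have := nn T.+1; lra.
rewrite addnS; split=> //; apply: le_trans (dec _ (leq_addr _ _)) _.
have -> : B * r ^+ (T + k).+2 = r ^+ 2 * (B * r ^+ (T + k)) by rewrite !exprS; ring.
by rewrite ler_pM2l // exprn_gt0.
Qed.

(** Two descent steps and the domination give [a * D t <= C * (D t - D t.+2)]. As [D] decreases,
    [D t.+2 <= C / (C + a) * D t], whose square root is the rate per step; finally
    [a * e t <= D t]. *)
Lemma linear_rate (D e : nat -> R) a C T : 0 < a -> 0 < C ->
  (forall t, 0 <= D t) -> (forall t, 0 <= e t) ->
  (forall t, D t.+1 + a * e t <= D t) ->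
  (forall t, (T <= t)%N -> D t <= C * (e t + e t.+1)) ->
  exists2 B, 0 < B & exists2 r, 0 < r < 1 & forall t, (T <= t)%N -> e t <= B * r ^+ t.
Proof.
move=> a0 C0 D0 e0 dec dom.
have Ca : 0 < C / (C + a) by rewrite divr_gt0 // addr_gt0.
have Ca1 : C / (C + a) < 1 by rewrite ltr_pdivrMr ?addr_gt0 // mul1r ltrDl.
set r := Num.sqrt (C / (C + a)).
have r0 : 0 < r by rewrite sqrtr_gt0.
have r2 : r ^+ 2 = C / (C + a) by rewrite sqr_sqrtr // ltW.
have r1 : r < 1 by rewrite -(@ltr_pXn2r _ 2) ?nnegrE ?ltW // r2 expr1n.
have [|B B0 HB] := @two_step_decay D r T r0 D0.
  move=> t Tt; rewrite r2 -mulrA mulrCA ler_pdivlMl ?addr_gt0 //.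
  have := dec t; have := dec t.+1; have := dom t Tt.
  have := mulr_ge0 (ltW a0) (e0 t.+1); have := mulr_ge0 (ltW a0) (e0 t) => ae ae1 d1 d2 d3.
  have : a * D t <= a * (C * (e t + e t.+1)) by rewrite ler_pM2l.
  have : C * (a * e t + a * e t.+1) <= C * (D t - D t.+2) by rewrite ler_pM2l //; lra.
  have : a * D t.+2 <= a * D t by rewrite ler_pM2l //; lra.
  lra.
exists (B / a); first exact: divr_gt0.
exists r; first by rewrite r0.
move=> t Tt; rewrite mulrAC ler_pdivlMr // mulrC.
by have := HB t Tt; have := dec t; have := D0 t.+1; lra.
Qed.

Lemma geometric_steps_rate (m n : nat) (x : nat -> 'M[R]_(m, n)) (xbar : 'M[R]_(m, n)) B r T :
  0 < B -> 0 < r < 1 -> x @ \oo --> xbar ->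
  (forall t, (T <= t)%N -> dot (x t.+1 - x t) (x t.+1 - x t) <= B * r ^+ t) ->
  exists2 c, 0 < c & exists2 eta, 0 < eta < 1 & forall t, (T <= t)%N ->
    enorm (@dot R m n) (x t - xbar) < c * eta ^+ t.
Proof.
move=> B0 /andP[r0 r1] xcv step.
(* The hypothesis bounds squared steps, so the steps themselves decay at the rate [Num.sqrt r]. *)
set eta := Num.sqrt r; set b := Num.sqrt B.
have eta0 : 0 < eta by rewrite sqrtr_gt0.
have eta1 : eta < 1 by rewrite -(@ltr_pXn2r _ 2) ?nnegrE ?ltW // sqr_sqrtr ?ltW // expr1n.
have b0 : 0 < b by rewrite sqrtr_gt0.
have K0 : 0 < b / (1 - eta) by rewrite divr_gt0 // subr_gt0.
have estep t : (T <= t)%N -> enorm (@dot R m n) (x t.+1 - x t) <= b * eta ^+ t.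
  move=> Tt; rewrite -ler_sqr ?nnegrE ?enorm_ge0 //; last by rewrite mulr_ge0 ?exprn_ge0 // ltW.
  by rewrite enormK exprMn -exprM mulnC exprM !sqr_sqrtr ?(ltW B0, ltW r0) // step.
(* The geometric series contributes [b / (1 - eta)]; the added 1 makes the final inequality
   strict. *)
exists (b / (1 - eta) + 1); first by rewrite addr_gt0.
exists eta; first by rewrite eta0.
move=> t Tt.
have tele k : enorm (@dot R m n) (x t - x (t + k)%N) <= b / (1 - eta) * (eta ^+ t - eta ^+ (t + k)).
  elim: k => [|k IH].
    by rewrite addn0 !subrr mulr0 /enorm dot0l sqrtr0.
  have -> : x t - x (t + k.+1)%N = (x t - x (t + k)%N) - (x (t + k).+1 - x (t + k)%N).
    by rewrite addnS opprB addrA subrK.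
  apply: le_trans (enormD _ _) _.
  have -> : enorm (@dot R m n) (- (x (t + k).+1 - x (t + k)%N)) =
            enorm (@dot R m n) (x (t + k).+1 - x (t + k)%N).
    by rewrite /enorm dotNl dotNr opprK.
  have := estep _ (leq_trans Tt (leq_addr k t)); rewrite addnS exprS => h.
  have -> : b / (1 - eta) * (eta ^+ t - eta * eta ^+ (t + k)) =
    b / (1 - eta) * (eta ^+ t - eta ^+ (t + k)) + b * eta ^+ (t + k).
    by field; rewrite subr_eq0 gt_eqF.
  exact: lerD.
have lim : enorm (@dot R m n) (x t - x (t + k)%N) @[k --> \oo] --> enorm (@dot R m n) (x t - xbar).
  apply: cvg_enorm; apply: cvgB; first exact: cvg_cst.
  have : [sequence x (k + t)%N]_k @ \oo --> nbhs xbar by rewrite cvg_shiftn.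
  by apply: cvg_trans; apply: near_eq_cvg; apply: nearW => k /=; rewrite addnC.
have : enorm (@dot R m n) (x t - xbar) <= b / (1 - eta) * eta ^+ t.
  apply: (ler_cvg_to lim (cvg_cst _)); apply: nearW => k.
  apply: le_trans (tele k) _; rewrite ler_pM2l // gerBl exprn_ge0 //; exact: ltW.
by move/le_lt_trans; apply; rewrite ltr_pM2r ?exprn_gt0 // ltrDl.
Qed.

End LinearRate.

(** * One iteration: optimality, descent and residual *)

Section Iteration.
Set Implicit Arguments.
Unset Strict Implicit.
Context {R : realType} {m n : nat}.
Local Notation X := 'M[R]_(m, n).
Context {f P1 P2 : X -> R} {hf h1 : X} {Hf H1 M : {linear X -> X}}.
Context {beta : nat -> R} {xi x : nat -> X} {L0 : R}.
Hypothesis quadf : quadratic f hf Hf.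
Hypothesis quadP1 : quadratic P1 h1 H1.
Hypothesis adjM : self_adjoint M.
Hypothesis geM : loewner_ge M L0.
Hypothesis L0_gt0 : 0 < L0.
Hypothesis algo : preDCAe f P1 P2 M beta xi x.
Local Notation y t := (extrapolation beta x t).
Local Notation e t := (sqnormM M (x t - x t.-1)).

Lemma quadratic_sqdist z : quadratic (fun w => 2^-1 * sqnormM M (w - z)) (- M z) M.
Proof.
split=> // w; rewrite /sqnormM !linearB linear0 /= !dotE ?dot0l ?dot0r ?(dotC w (M z)) ?adjM.
by field.
Qed.

Lemma sqnormM_ge z : L0 * dot z z <= sqnormM M z.
Proof. exact: geM. Qed.

Lemma sqnormM_ge0 z : 0 <= sqnormM M z.
Proof. by apply: le_trans (geM z); rewrite mulr_ge0 ?dot_ge0 // ltW. Qed.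

Lemma quadratic_subproblem t :
  quadratic (fun z => dot (gradient f (y t) - xi t) z
                      + 2^-1 * sqnormM M (z - y t) + P1 z)
    (hf + Hf (y t) - xi t - M (y t) + h1) ((\0 \+ M) \+ H1).
Proof.
apply: quadraticD quadP1; apply: quadraticD (quadratic_sqdist _).
rewrite (quadratic_gradient _ quadf).
by apply: quadratic_ext (quadratic_affine 0 _) => z; rewrite add0r.
Qed.

Lemma preDCAe_optimality t :
  hf + Hf (y t) - xi t - M (y t) + h1 + (M (x t.+1) + H1 (x t.+1)) = 0.
Proof.
have [_ _ _ /(_ t) min] := algo.
by have := quadratic_argmin (quadratic_subproblem t) min; rewrite /= add0r.
Qed.

(** Four relations are added: the expansion of the subproblem at its minimizer, the upper bound of
    [f] at [x t.+1] from [y t] (its curvature is below [M]), the convexity bound of [f] at [x t],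
    and the subgradient inequality for [P2]. *)
Lemma preDCAe_descent t : (forall w, 0 <= dot w (Hf w)) ->
  (forall w, dot w (Hf w) <= L0 * dot w w) -> (forall w, 0 <= dot w (H1 w)) ->
  let F z := f z + P1 z - P2 z in
  F (x t.+1) + 2^-1 * e t.+1 <= F (x t) + 2^-1 * beta t ^+ 2 * e t.
Proof.
move=> psdf fL0 psd1 /=.
have [_ _ /(_ t (x t.+1)) subg _] := algo.
have opt := preDCAe_optimality t.
(* The linear term vanishes by optimality, leaving the full curvature [M + H1] along [x t - x t.+1];
   its [M] part is [e t.+1]. *)
have := quadratic_shift (x t.+1) (x t - x t.+1) (quadratic_subproblem t).
rewrite [x t.+1 + _]addrC subrK /= [_ + H1 (x t.+1)](_ : _ = M (x t.+1) + H1 (x t.+1)); last first.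
  by rewrite add0r.
rewrite opt dot0l add0r addr0 (quadratic_gradient _ quadf) => sub.
have f1 := quadratic_shift (y t) (x t.+1 - y t) quadf.
have f0 := quadratic_shift (y t) (x t - y t) quadf.
rewrite [y t + _]addrC subrK in f1; rewrite [y t + _]addrC subrK in f0.
have := fL0 (x t.+1 - y t); have := psdf (x t - y t).
have := psd1 (x t - x t.+1); have := sqnormM_ge (x t.+1 - y t).
have ey : sqnormM M (x t - y t) = beta t ^+ 2 * e t.
  have -> : x t - y t = - (beta t *: (x t - x t.-1)).
    by rewrite /extrapolation opprD addrA subrr add0r.
  by move: (x t - x t.-1) => p; rewrite /sqnormM -scaleNr linearZ_LR dotZl dotZr; ring.
have eM : dot (x t - x t.+1) (M (x t - x t.+1)) = e t.+1.
  by rewrite -[x t - _]opprB /sqnormM /= linearN dotNl dotNr opprK.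
rewrite ey dotDr eM in sub.
move: (sqnormM M (x t.+1 - y t)) sub => s sub.
move: (dot (x t.+1 - y t) (Hf _)) f1 => df1 f1.
move: (dot (x t - y t) (Hf _)) f0 => df0 f0.
move: (dot (x t - _) (H1 _)) sub => d1 sub.
move: (dot (x t.+1 - y t) (x t.+1 - y t)) => q.
move: subg f1 f0 sub; move: (hf + Hf (y t)) => g.
rewrite !(dotDr, dotNr, dotDl, dotNl) => subg f1 f0 sub.
lra.
Qed.

(** The optimality equation, recentred at [x t], writes the gradient of [f + P1] minus [xi t] as a
    linear image of the last two steps. *)
Lemma preDCAe_residual : exists2 K, 0 < K & forall t,
  let g := hf + Hf (x t) + (h1 + H1 (x t)) - xi t in dot g g <= K * (e t + e t.+1).
Proof.
have [C1 C1_gt0 HC1] := linear_bounded (H1 \+ M).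
have [C2 C2_gt0 HC2] := linear_bounded (M \- Hf).
exists ((2 * C1 + 2 * C2) / L0); first by rewrite divr_gt0 // addr_gt0 // mulr_gt0.
move=> t; have [b01 _ _ _] := algo; have /andP[b0 b1] := b01 t.
set u := x t.+1 - x t; set p := x t - x t.-1; rewrite /=.
have -> : hf + Hf (x t) + (h1 + H1 (x t)) - xi t =
    - (H1 \+ M) u + (M \- Hf) (beta t *: p).
  have := preDCAe_optimality t; have -> : x t.+1 = x t + u by rewrite addrC subrK.
  have -> : y t = x t + beta t *: p by [].
  move: (beta t *: p) => w /eqP; rewrite !linearD /= => /eqP opt.
  apply/eqP; rewrite -subr_eq0 -opt; apply/eqP.
  apply/matrixP => i j; rewrite !mxE; ring.
apply: le_trans (dot_triangle2 _ _) _; rewrite dotNl dotNr opprK.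
have := HC1 u; have := HC2 (beta t *: p); rewrite (dotZl _ p) (dotZr _ p) mulrA -expr2.
have := sqnormM_ge u; have := sqnormM_ge p; have := dot_ge0 p; have := dot_ge0 u.
have bb : beta t ^+ 2 <= 1 by rewrite expr_le1 // ltW.
move: (dot ((H1 \+ M) u) _) (dot ((M \- Hf) _) _) => a1 a2.
have := sqnormM_ge0 u; have := sqnormM_ge0 p.
move: (sqnormM M u) (sqnormM M p) (dot u u) (dot p p) => eu ep du dp.
move=> ep0 eu0 du0 dp0 ep_ge eu_ge a2_le a1_le.
have dp_le : dp <= ep / L0 by rewrite ler_pdivlMr // mulrC.
have du_le : du <= eu / L0 by rewrite ler_pdivlMr // mulrC.
have bdp : beta t ^+ 2 * dp <= dp by rewrite ler_piMl.
have q1 : a1 <= C1 * (eu / L0) by apply: le_trans a1_le _; rewrite ler_pM2l.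
have q2 : a2 <= C2 * (ep / L0).
  by apply: le_trans a2_le _; rewrite ler_pM2l //; apply: le_trans dp_le.
have -> : (2 * C1 + 2 * C2) / L0 * (ep + eu) =
  2 * (C1 * (eu / L0)) + 2 * (C2 * (ep / L0)) + (2 * (C1 * (ep / L0)) + 2 * (C2 * (eu / L0))).
  by ring.
have : 0 <= C1 * (ep / L0) by rewrite mulr_ge0 ?divr_ge0 // ltW.
have : 0 <= C2 * (eu / L0) by rewrite mulr_ge0 ?divr_ge0 // ltW.
lra.
Qed.

End Iteration.

(** * Linear convergence of the iterates *)

Section Convergence.
Set Implicit Arguments.
Unset Strict Implicit.
Context {R : realType} {m n : nat} {S : finType}.
Local Notation X := 'M[R]_(m, n).

Lemma eventually_near_min F (Q : S -> X -> R) h H (x : nat -> X) xbar eps :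
  min_of_quadratics F Q h H -> x @ \oo --> xbar -> 0 < eps ->
  \forall t \near \oo, F xbar - eps < F (x t).
Proof.
move=> [quadQ FQ act _] xcv eps0.
have near_s s : \forall t \near \oo, Q s xbar - eps < Q s (x t).
  apply: (cvgr_gt _ (quadratic_cvg (f := x) (quadQ s) xcv)).
  by rewrite ltrBlDr ltrDl.
have ev := @filter_forall _ S (fun s t => Q s xbar - eps < Q s (x t)) \oo _ near_s.
near=> t; have Qt : forall s, Q s xbar - eps < Q s (x t) by near: t; exact: ev.
by have [s ->] := act (x t); apply: le_lt_trans (Qt s); rewrite lerB.
Unshelve. all: by end_near.
Qed.

Lemma preDCAe_linear_rate (F f P1 P2 : X -> R) (Q : S -> X -> R) h H hf h1
    (Hf H1 M : {linear X -> X}) (L0 : R) beta (xi x : nat -> X) (xbar : X) :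
  (forall z, F z = f z + P1 z - P2 z) ->
  quadratic f hf Hf -> quadratic P1 h1 H1 ->
  (forall w, 0 <= dot w (Hf w)) -> (forall w, dot w (Hf w) <= L0 * dot w w) ->
  (forall w, 0 <= dot w (H1 w)) ->
  min_of_quadratics F Q h H ->
  self_adjoint M -> loewner_ge M L0 -> 0 < L0 ->
  preDCAe f P1 P2 M beta xi x ->
  (forall t, exists2 s, F (x t) = Q s (x t) &
     h s + H s (x t) = hf + Hf (x t) + (h1 + H1 (x t)) - xi t) ->
  x @ \oo --> xbar ->
  exists2 T, (0 < T)%N & exists2 c, 0 < c & exists2 eta, 0 < eta < 1 &
    forall t, (T <= t)%N -> enorm (@dot R m n) (x t - xbar) < c * eta ^+ t.
Proof.
move=> FE quadf quadP1 psdf fL0 psd1 minF adjM geM L0_gt0 algo branch xcv.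
have [quadQ FQ act F0] := minF.
pose e t := sqnormM M (x t - x t.-1).
(* The gap between the potential at [(x t, x t.-1)] and at [(xbar, xbar)]. *)
pose D t := F (x t) + 2^-1 * e t - F xbar.
have e0 t : 0 <= e t by exact: sqnormM_ge0 geM L0_gt0 _.
have [b01 supb _ _] := algo.
set b := sup (range beta) in supb.
have betab t : beta t <= b.
  apply: ub_le_sup; last by exists t.
  by exists 1 => _ [k _ <-]; have /andP[_ /ltW] := b01 k.
have b0 : 0 <= b by apply: le_trans (betab 0%N); case/andP: (b01 0%N).
(* What remains of the half weight on [e t] after the extrapolation, with [beta t] at most
   [b < 1]. *)
pose a := 2^-1 * (1 - b ^+ 2).
have a0 : 0 < a by rewrite mulr_gt0 // subr_gt0 expr_lt1.
have dec t : D t.+1 + a * e t <= D t.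
  have := preDCAe_descent quadf quadP1 adjM geM algo t psdf fL0 psd1.
  rewrite /= -!FE -/(e t) -[sqnormM _ _]/(e t.+1) /D /a.
  have : beta t ^+ 2 * e t <= b ^+ 2 * e t.
    by rewrite ler_wpM2r // ler_sqr ?nnegrE //; case/andP: (b01 t).
  lra.
have Dmono t k : D (t + k)%N <= D t.
  elim: k => [|k IH]; first by rewrite addn0.
  rewrite addnS; apply: le_trans IH; apply: le_trans (dec _).
  by rewrite lerDl mulr_ge0 // ltW.
(* A negative value would bound all later ones, while [F (x t)] eventually exceeds [F xbar - eps]
   for every [eps > 0]. *)
have D0 t : 0 <= D t.
  rewrite leNgt; apply/negP => Dt; have eps0 : 0 < - D t by rewrite oppr_gt0.
  have [T _ HT] := eventually_near_min minF xcv eps0.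
  have := HT (t + T)%N (leq_addl _ _); have := Dmono t T; have := e0 (t + T)%N.
  by rewrite /= opprK /D; lra.
have [T _ HT] := xcv _ (near_active xbar minF).
have [C C0 HC] := min_gradient_domination minF.
have [K K0 HK] := preDCAe_residual quadf quadP1 adjM geM L0_gt0 algo.
have CK : 0 < C * K + 1 by rewrite addr_gt0 // mulr_gt0.
(* From [T] on, the piece active at [x t] is active at [xbar], so the gap of [F] is that of one
   quadratic. The extra 1 absorbs [2^-1 * e t]. *)
have dom t : (T <= t)%N -> D t <= (C * K + 1) * (e t + e t.+1).
  move=> Tt; have [s Fs gs] := branch t.
  have Fbar : F xbar = Q s xbar by apply: HT Fs.
  have := HC s (x t) xbar; rewrite gs -Fs -Fbar.
  have : C * dot (hf + Hf (x t) + (h1 + H1 (x t)) - xi t)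
                 (hf + Hf (x t) + (h1 + H1 (x t)) - xi t) <= C * (K * (e t + e t.+1)).
    by rewrite ler_pM2l //; exact: HK.
  by rewrite /D; have := e0 t; have := e0 t.+1; lra.
have [B B0 [r r01 HB]] := linear_rate a0 CK D0 e0 dec dom.
have Br0 : 0 < B * r / L0 by rewrite divr_gt0 // mulr_gt0 //; case/andP: r01.
have [|c c0 [eta eta01 Heta]] := @geometric_steps_rate R m n x xbar (B * r / L0) r T Br0 r01 xcv.
  (* The step from [x t] to [x t.+1] is measured by [e t.+1], whence the factor [r]; [M >= L0] gives
     the division by [L0]. *)
  move=> t Tt; rewrite mulrAC ler_pdivlMr // mulrC -mulrA -exprS.
  by apply: le_trans (HB _ (leqW Tt)); exact: geM.
exists T.+1 => //; exists c => //; exists eta => // t Tt.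
by apply: Heta; exact: ltnW.
Qed.

End Convergence.

(** * The truncated quadratic functionals *)

Section TruncatedQuadraticModel.
Set Implicit Arguments.
Unset Strict Implicit.
Context {R : realType} {m n m0 n0 : nat}.
Local Notation X := 'M[R]_(m, n).
Local Notation masks := {ffun 'I_2 -> 'M[bool]_(m, n)}.
Implicit Types (x y : X) (b : 'I_2 -> 'M[bool]_(m, n)).
Variables (lambda mu : R) (A : {linear X -> 'M[R]_(m0, n0)}) (x0 : 'M[R]_(m0, n0)).
Variables (v : tq_model) (d : tq_splitting).
Hypotheses (lambda_gt0 : 0 < lambda) (mu_gt0 : 0 < mu).

Lemma adjoint_linear p q (W : lmodType R) (ip : W -> W -> R) (g : 'M[R]_(p, q) -> W) :
  (forall u, linear (ip u : W -> R^o)) -> linear (adjoint ip g).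
Proof.
by move=> lin a w1 w2; apply/matrixP => i j; rewrite !mxE lin.
Qed.

Lemma dot_linear p q (u : 'M[R]_(p, q)) : linear (dot u : 'M[R]_(p, q) -> R^o).
Proof. by move=> a y z; rewrite dotDr dotZr. Qed.

Lemma dot_adjoint p q (g : X -> 'M[R]_(p, q)) x w :
  linear g -> dot x (adjoint (@dot R p q) g w) = dot (g x) w.
Proof.
by move=> lin; rewrite (@adjointP R m n _ _ g) // => a y z; rewrite dotDl dotZl.
Qed.

Lemma nablal_linear (l : 'I_2) : linear (@nablal R m n l).
Proof.
move=> a x y; rewrite /nablal; case: ifP => _; apply/matrixP => i j; rewrite !mxE.
  by case: insub => [i'|]; rewrite ?mxE; ring.
by case: insub => [i'|]; rewrite ?mxE; ring.
Qed.

Definition mask (c : 'M[bool]_(m, n)) y : X := \matrix_(i, j) if c i j then y i j else 0.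

Lemma mask_linear c : linear (mask c).
Proof.
by move=> a x y; apply/matrixP => i j; rewrite !mxE; case: ifP => // _; ring.
Qed.

Lemma dot_mask c x y : dot x (mask c y) = \sum_i \sum_j if c i j then x i j * y i j else 0.
Proof.
apply: eq_bigr => i _; apply: eq_bigr => j _; rewrite mxE.
by case: ifP => // _; rewrite mulr0.
Qed.

(** For fixed masks this is the Hessian of half [mu] times the sum of the squared differences kept
    by the masks. *)
Definition masked_laplacian b x : X :=
  mu *: \sum_(l < 2) adjoint (@dot R m n) (@nablal R m n l) (mask (b l) (nablal l x)).

Lemma masked_laplacian_linear b : linear (masked_laplacian b).
Proof.
move=> a x y; rewrite /masked_laplacian scalerA mulrC -scalerA -scalerDr.
congr (_ *: _); rewrite scaler_sumr -big_split; apply: eq_bigr => l _ /=.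
rewrite nablal_linear mask_linear adjoint_linear //; exact: dot_linear.
Qed.

HB.instance Definition _ b :=
  GRing.isLinear.Build R X X _ (masked_laplacian b) (@masked_laplacian_linear b).

Lemma dot_masked_laplacian b x y : dot x (masked_laplacian b y) =
  mu * \sum_(l < 2) \sum_i \sum_j
    if b l i j then nablal l x i j * nablal l y i j else 0.
Proof.
rewrite dotZr (big_morph (dot x) (dotDr x) (dot0r x)); congr (_ * _).
by apply: eq_bigr => l _; rewrite dot_adjoint ?dot_mask //; exact: nablal_linear.
Qed.

Lemma masked_laplacian_sym b : self_adjoint (masked_laplacian b).
Proof.
move=> x y; rewrite dotC !dot_masked_laplacian; congr (_ * _).
do 3!apply: eq_bigr => ? _; by rewrite mulrC.
Qed.

(** In the isotropic model both directions share one mask, read off at [ord0], so that one finite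
    index type serves both models. *)
Definition model_mask (s : masks) : 'I_2 -> 'M[bool]_(m, n) :=
  match v with ITQ => fun=> s ord0 | ATQ => s end.

(* [tqP2] with the maximum at each pixel resolved by a fixed mask. *)
Definition tqP2_mask (s : masks) x : R :=
  match v with
  | ITQ => \sum_i \sum_j mu / 2 * (if s ord0 i j then pixnorm x i j ^+ 2 else lambda / mu)
  | ATQ => \sum_i \sum_j \sum_l
      mu / 2 * (if s l i j then `|nablal l x i j| ^+ 2 else lambda / mu)
  end.

Lemma sum_I2 (G : 'I_2 -> R) : \sum_l G l = G ord0 + G (lift ord0 ord0).
Proof. by rewrite !big_ord_recl big_ord0 addr0. Qed.

Lemma pixnorm_sqr x i j : pixnorm x i j ^+ 2 =
  nablal ord0 x i j ^+ 2 + nablal (lift ord0 ord0) x i j ^+ 2.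
Proof. by rewrite sqr_sqrtr // addr_ge0 ?sqr_ge0. Qed.

Lemma tqP2_mask_quadratic s :
  quadratic (tqP2_mask s) 0 (masked_laplacian (model_mask s)).
Proof.
(* The constant [c] collects the values [lambda / mu] at the pixels outside the mask. *)
have [c cE] : exists c, forall x, c +
  2^-1 * dot x (masked_laplacian (model_mask s) x) = tqP2_mask s x.
  rewrite /tqP2_mask /model_mask; case: v.
    exists (\sum_i \sum_j mu / 2 * (if s ord0 i j then 0 else lambda / mu)) => x.
    rewrite dot_masked_laplacian sum_I2 -!big_split mulrA mulr_sumr -big_split.
    apply: eq_bigr => i _; rewrite -big_split mulr_sumr -big_split.
    apply: eq_bigr => j _ /=; rewrite pixnorm_sqr.
    by case: ifP => _; rewrite ?expr2; ring.
  exists (\sum_i \sum_j \sum_l mu / 2 * (if s l i j then 0 else lambda / mu)) => x.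
  rewrite dot_masked_laplacian sum_I2 -!big_split mulrA mulr_sumr -big_split.
  apply: eq_bigr => i _; rewrite -big_split mulr_sumr -big_split.
  apply: eq_bigr => j _ /=; rewrite !sum_I2 !real_normK ?num_real //.
  by case: ifP => _; case: ifP => _; rewrite ?expr2; ring.
apply: quadratic_ext cE _; apply: quadratic_form; exact: masked_laplacian_sym.
Qed.

(** The comparison is non-strict as in [chi], so the prescribed subgradient comes from this mask; at
    a tie both choices attain the maximum. *)
Definition active_mask x : masks :=
  [ffun l => \matrix_(i, j) (Num.sqrt (lambda / mu) <=
     match v with ITQ => pixnorm x i j | ATQ => `|nablal l x i j| end)].

(** Identifies the prescribed subgradient with the gradient at [x] of the quadratic piece of [P2]
    selected by the active mask. In the isotropic case the adjoint on pairs splits into the two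
    directional adjoints. *)
Lemma tq_subgradientE x :
  tq_subgradient lambda mu v x = masked_laplacian (model_mask (active_mask x)) x.
Proof.
rewrite /tq_subgradient /masked_laplacian /model_mask /active_mask.
case: v => /=; congr (_ *: _).
  apply/matrixP => i j; rewrite summxE sum_I2 !mxE /dot2 /=; congr (_ + _).
    by apply: eq_bigr => k _; apply: eq_bigr => l _; rewrite !mxE ffunE mxE.
  by apply: eq_bigr => k _; apply: eq_bigr => l _; rewrite !mxE ffunE mxE.
apply: eq_bigr => l _; congr adjoint.
by apply/matrixP => i j; rewrite !mxE ffunE mxE.
Qed.

Lemma sqrt_le_sqr (s : R) : 0 <= s ->
  (Num.sqrt (lambda / mu) <= s) = (lambda / mu <= s ^+ 2).
Proof.
move=> s0; rewrite -(@ler_sqr _ _ s) ?nnegrE ?sqrtr_ge0 // sqr_sqrtr //.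
by rewrite divr_ge0 ?ltW.
Qed.

Lemma mask_le_max (c : bool) (s : R) :
  mu / 2 * (if c then s ^+ 2 else lambda / mu) <= mu / 2 * Num.max (s ^+ 2) (lambda / mu).
Proof.
rewrite ler_pM2l ?divr_gt0 //; case: c; by rewrite le_max lexx ?orbT.
Qed.

Lemma tqP2_mask_le s x : tqP2_mask s x <= tqP2 lambda mu v x.
Proof.
rewrite /tqP2_mask /tqP2 /pixel_sum; case: v.
  by do 2!apply: ler_sum => ? _; exact: mask_le_max.
by do 3!apply: ler_sum => ? _; exact: mask_le_max.
Qed.

Lemma mask_eq_max (s : R) : 0 <= s ->
  mu / 2 * Num.max (s ^+ 2) (lambda / mu) =
  mu / 2 * (if Num.sqrt (lambda / mu) <= s then s ^+ 2 else lambda / mu).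
Proof.
move=> s0; rewrite sqrt_le_sqr //; case: ifPn => [/max_l -> //|].
by rewrite -ltNge => /ltW/max_r ->.
Qed.

Lemma tqP2_active x : tqP2 lambda mu v x = tqP2_mask (active_mask x) x.
Proof.
rewrite /tqP2_mask /tqP2 /pixel_sum /active_mask; case: v.
  do 2!apply: eq_bigr => ? _; rewrite ffunE mxE mask_eq_max //; exact: sqrtr_ge0.
by do 3!apply: eq_bigr => ? _; rewrite ffunE mxE mask_eq_max.
Qed.

Lemma pixel_sum_ge0 (phi : R -> R) x : (forall t, 0 <= phi t) -> 0 <= pixel_sum v phi x.
Proof.
by move=> phi0; rewrite /pixel_sum; case: v; do !(apply: sumr_ge0 => ? _).
Qed.

Lemma pixel_sumD (phi1 phi2 : R -> R) x :
  pixel_sum v (fun t => phi1 t + phi2 t) x = pixel_sum v phi1 x + pixel_sum v phi2 x.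
Proof.
rewrite /pixel_sum; case: v.
  by rewrite -big_split; apply: eq_bigr => i _; rewrite -big_split.
rewrite -big_split; apply: eq_bigr => i _; rewrite -big_split.
by apply: eq_bigr => j _; rewrite -big_split.
Qed.

(** The Hessian is the normal operator, [A] followed by its adjoint. *)
Lemma data_term_quadratic : exists h (H : {linear X -> X}), quadratic (data_term A x0) h H.
Proof.
pose H := adjoint (@dot R m0 n0) A \o A.
have linH : linear H.
  move=> a y z; rewrite /H /= linearP adjoint_linear //; exact: dot_linear.
pose H' : {linear X -> X} := HB.pack H (GRing.isLinear.Build R X X _ H linH).
have HE y z : dot y (H z) = dot (A y) (A z) by rewrite /H /= dot_adjoint //; exact: linearP.
exists (- adjoint (@dot R m0 n0) A x0), H'; split=> [y z|z] /=.
  by rewrite dotC !HE dotC.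
rewrite /data_term !enormK HE dotNl dotC dot_adjoint; last exact: linearP.
by rewrite linear0 !dotE !dot0l !dot0r (dotC x0 (A z)); field.
Qed.

Lemma data_term_ge0 x : 0 <= data_term A x0 x.
Proof. by rewrite mulr_ge0 ?invr_ge0 // sqr_ge0. Qed.

Lemma tqf_quadratic : exists h (H : {linear X -> X}), quadratic (tqf A x0 d) h H.
Proof.
rewrite /tqf; case: d; first exact: data_term_quadratic.
by exists 0, \0; apply: quadratic_ext (quadratic_affine 0 0) => x; rewrite dot0l addr0.
Qed.

Lemma tqf_ge0 x : 0 <= tqf A x0 d x.
Proof. by rewrite /tqf; case: d => //; exact: data_term_ge0. Qed.

Lemma penalty_quadratic : exists h (H : {linear X -> X}),
  quadratic (pixel_sum v (fun s => mu / 2 * (s ^+ 2 + lambda / mu))) h H.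
Proof.
(* With every pixel kept, the masked form is the untruncated squared gradient of [P1], up to the
   constant [k]. *)
pose T : masks := [ffun=> const_mx true].
exists 0, (masked_laplacian (model_mask T)).
pose k := pixel_sum v (fun=> mu / 2 * (lambda / mu)) (0 : X).
have kE x : tqP2_mask T x + k =
    pixel_sum v (fun s => mu / 2 * (s ^+ 2 + lambda / mu)) x.
  rewrite [RHS](_ : _ = pixel_sum v (fun s => mu / 2 * s ^+ 2 + mu / 2 * (lambda / mu)) x).
    rewrite pixel_sumD /k /tqP2_mask /pixel_sum; case: v; congr (_ + _).
      by do 2!apply: eq_bigr => ? _; rewrite ffunE mxE.
    by do 3!apply: eq_bigr => ? _; rewrite ffunE mxE.
  by congr pixel_sum; apply/funext => s; rewrite mulrDr.
have [sym e] := tqP2_mask_quadratic T.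
by split=> // x; rewrite -!kE e; ring.
Qed.

Lemma tqP1_quadratic : exists h (H : {linear X -> X}),
  quadratic (tqP1 lambda mu A x0 v d) h H.
Proof.
have [h [H Q]] := penalty_quadratic; rewrite /tqP1; case: d; first by exists h, H.
have [h' [H' Q']] := data_term_quadratic.
by exists (h' + h), (H' \+ H); exact: quadraticD.
Qed.

Lemma tqP1_ge0 x : 0 <= tqP1 lambda mu A x0 v d x.
Proof.
have P0 : 0 <= pixel_sum v (fun s => mu / 2 * (s ^+ 2 + lambda / mu)) x.
  apply: pixel_sum_ge0 => s; rewrite mulr_ge0 ?divr_ge0 ?addr_ge0 ?sqr_ge0 ?divr_ge0 //; exact: ltW.
by rewrite /tqP1; case: d => //; rewrite addr_ge0 ?data_term_ge0.
Qed.

Lemma tqF_ge0 x : 0 <= tqF lambda mu A x0 v x.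
Proof.
rewrite addr_ge0 ?data_term_ge0 //; apply: pixel_sum_ge0 => s.
by rewrite mulr_ge0 ?divr_ge0 ?le_min ?sqr_ge0 ?divr_ge0 // ltW.
Qed.

(** At each pixel the minimum and the maximum of two numbers add up to their sum. *)
Lemma tqFE x : tqF lambda mu A x0 v x =
  tqf A x0 d x + tqP1 lambda mu A x0 v d x - tqP2 lambda mu v x.
Proof.
have -> : tqf A x0 d x + tqP1 lambda mu A x0 v d x = data_term A x0 x +
    pixel_sum v (fun s => mu / 2 * (s ^+ 2 + lambda / mu)) x.
  by rewrite /tqf /tqP1; case: d; rewrite // add0r.
rewrite /tqF -addrA; congr (_ + _); apply/eqP; rewrite eq_sym subr_eq; apply/eqP.
rewrite /tqP2 -pixel_sumD; congr pixel_sum; apply/funext => s.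
by rewrite -mulrDr addr_min_max.
Qed.

End TruncatedQuadraticModel.

Theorem theorem4 (R : realType) (m n m0 n0 : nat) (lambda mu : R)
    (A : {linear 'M[R]_(m, n) -> 'M[R]_(m0, n0)}) (x0 : 'M[R]_(m0, n0))
    (v : tq_model) (d : tq_splitting)
    (M : {linear 'M[R]_(m, n) -> 'M[R]_(m, n)}) (L L0 : R)
    (beta : nat -> R) (xi x : nat -> 'M[R]_(m, n)) (xbar : 'M[R]_(m, n)) :
  let F := tqF lambda mu A x0 v in
  let f := tqf A x0 d in
  let P1 := tqP1 lambda mu A x0 v d in
  let P2 := tqP2 lambda mu v in
  let E := potential F M in
  0 < lambda -> 0 < mu ->
  lipschitz_constant (gradient f) L ->
  self_adjoint M -> loewner_ge M L0 -> 0 < L0 -> L <= L0 ->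
  level_bounded F ->
  preDCAe f P1 P2 M beta xi x ->
  (forall t, xi t = tq_subgradient lambda mu v (x t)) ->
  x @ \oo --> xbar ->
  (forall z, stationary (@dot2 R m n) E z ->
     exists2 c : R, 0 < c &
       KL_at (@dot2 R m n) E (desingularizing c 2^-1) z) /\
  exists (c1 : R) (t0 : nat) (eta : R),
    [/\ 0 < c1, (0 < t0)%N, 0 < eta < 1 &
        forall t : nat, (t0 < t)%N ->
          enorm (@dot R m n) (x t - xbar) < c1 * eta ^+ t].
Proof.
move=> F f P1 P2 E lambda0 mu0 lipf symM geM L0_gt0 LL0 _ algo xiE xcv.
have [hf [Hf quadf]] := tqf_quadratic A x0 d.
have [h1 [H1 quadP1]] := tqP1_quadratic lambda mu A x0 v d.
have f0 := tqf_ge0 A x0 d; have P10 := tqP1_ge0 A x0 v d lambda0 mu0.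
pose lap s : {linear 'M[R]_(m, n) -> 'M[R]_(m, n)} := masked_laplacian mu (model_mask v s).
(* [P2] is the maximum of its masked versions, so subtracting these instead of [P2] presents [F] as
   the minimum of the [Q s]. *)
pose Q s z := f z + P1 z - tqP2_mask lambda mu v s z.
have minF : min_of_quadratics F Q (fun=> hf + h1 - 0) (fun s => (Hf \+ H1) \- lap s).
  split=> [s|s z|z|z].
  - exact: quadraticB (quadraticD quadf quadP1) (tqP2_mask_quadratic _ _ _ s).
  - by rewrite /F (tqFE _ _ _ _ _ d) lerB // tqP2_mask_le.
  - by exists (active_mask lambda mu v z); rewrite /F (tqFE _ _ _ _ _ d) tqP2_active.
  - exact: tqF_ge0.
split; first by move=> z _; exact: (potential_KL z minF symM geM L0_gt0).
(* Convexity of [f] and [P1] is read off from their nonnegativity: a quadratic bounded below has a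
   positive semidefinite Hessian. *)
have psdf w : 0 <= dot w (Hf w) by case: (quadratic_ge0_psd quadf f0 w).
have psd1 w : 0 <= dot w (H1 w) by case: (quadratic_ge0_psd quadP1 P10 w).
have fL0 w : dot w (Hf w) <= L0 * dot w w.
  by apply: le_trans (lipschitz_hessian w quadf lipf) _; rewrite ler_wpM2r ?dot_ge0.
have [|T T0 [c c0 [eta eta01 rate]]] := preDCAe_linear_rate (tqFE lambda mu A x0 v d)
  quadf quadP1 psdf fL0 psd1 minF symM geM L0_gt0 algo _ xcv.
  move=> t; exists (active_mask lambda mu v (x t)).
    by rewrite (tqFE _ _ _ _ _ d) tqP2_active.
  by rewrite xiE tq_subgradientE /= subr0 addrA addrACA.
by exists c, T, eta; split=> // t Tt; apply: rate; exact: ltnW.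
Qed.
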